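(* Let $D\subseteq\mathbb{Z}^2$ be a finite set and assume there is an integer $t_0$ such that, for every complex number $t\neq t_0$, the polynomial $f_D-t=\sum_{\vec u\in D}X^{-\vec u}-t$ has no line polynomial factors. Then every $D$-perfect coloring whose matrix $\mathbf{B}$ satisfies $\det(\mathbf{B}-t_0\mathbf{I})\neq0$ is two-periodic. Moreover, if $f_D-t$ has no line polynomial factors for any $t$, then every $D$-perfect coloring is two-periodic.
   Context: Write $X^{\vec u}=x^{u_1}y^{u_2}$. A line polynomial is a Laurent polynomial in $\mathbb{C}[x^{\pm1},y^{\pm1}]$ whose support has at least two points, all on one line of $\mathbb{Z}^2$. A polynomial has a line polynomial factor if it is divisible in $\mathbb{C}[x^{\pm1},y^{\pm1}]$ by a line polynomial. For a finite alphabet $\mathcal{A}=\{a_1,\dots,a_n\}$, a configuration $c\in\mathcal{A}^{\mathbb{Z}^2}$ is a $D$-perfect coloring with matrix $\mathbf{B}=(b_{ij})_{n\times n}$ if for all $i,j$ and every $\vec u$ with $c_{\vec u}=a_j$, the number of $\vec v\in\vec u+D$ with $c_{\vec v}=a_i$ equals $b_{ij}$. $\mathbf{I}$ is the $n\times n$ identity matrix. A configuration is two-periodic if there are two linearly independent $\vec t_1,\vec t_2\in\mathbb{Z}^2$ with $c_{\vec u+\vec t_i}=c_{\vec u}$ for all $\vec u$ and $i=1,2$. *)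

(* Defs.v *)
From HB Require Import structures.
From mathcomp Require Import all_boot all_order all_algebra.
From mathcomp Require Import finmap complex reals.
From mathcomp.multinomials Require Import monalg.

Set Implicit Arguments.
Unset Strict Implicit.
Unset Printing Implicit Defensive.

Import GRing.Theory.
Local Open Scope fset_scope.
Local Open Scope ring_scope.

Notation Z2 := (int * int)%type.

(* Laurent polynomials in two variables: [<< a *g u >>] is a X^u, [p@_u] is the
   coefficient of X^u in p and [msupp p] is the support of p.  The library only
   multiplies elements of [{malg _[K]}] when the monoid K has no nontrivial
   units, so the product is defined here by the same formula. *)
Notation laurent K := {malg K[Z2]}.

Section Laurent.
Variable K : fieldType.
Implicit Types p q : laurent K.

Definition lmul p q : laurent K :=
  \sum_(u <- msupp p) \sum_(v <- msupp q) << p@_u * q@_v *g u + v >>.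

Definition ldvd p q : Prop := exists r, q = lmul p r.

(* A line is given by an equation a x + b y = e with (a, b) <> (0, 0). *)
Definition line_poly p : Prop :=
  (2 <= #|` msupp p|)%N /\
  exists a b e : int, (a, b) != (0, 0) /\
    (forall u : Z2, u \in msupp p -> a * u.1 + b * u.2 = e).

Definition has_line_factor q : Prop := exists2 p, line_poly p & ldvd p q.

Definition shape_poly (D : {fset Z2}) : laurent K :=
  \sum_(u <- D) << 1 *g - u >>.

Definition shape_poly_sub (D : {fset Z2}) (t : K) : laurent K :=
  shape_poly D - << t *g 0 >>.

End Laurent.

(* The letters of an n-letter alphabet are identified with their indices. *)
Definition config n := Z2 -> 'I_n.

Definition perfect_coloring n (D : {fset Z2}) (B : 'M[int]_n) (c : config n) :
    Prop :=
  forall (i j : 'I_n) (u : Z2), c u = j ->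
    #|` [fset v in [fset u + d | d in D] | c v == i]|%:Z = B i j.

Definition lin_indep (t1 t2 : Z2) : Prop :=
  forall a b : int, t1 *~ a + t2 *~ b = 0 -> a = 0 /\ b = 0.

Definition two_periodic n (c : config n) : Prop :=
  exists t1 t2 : Z2, lin_indep t1 t2 /\
    (forall u : Z2, c (u + t1) = c u) /\ (forall u : Z2, c (u + t2) = c u).

(* Main.v *)
(* The indicators of the letters satisfy [f_D h = B h], so they are killed by the
   integral Laurent polynomial [F = det (f_D - B)], nonzero because [f_D = t] for
   an eigenvalue [t] would make every line polynomial a factor of [f_D - t].  The indicators are bounded and [F(X)^p = F(X^p)] mod
   [p], so [F(X^p)] kills them too for every large prime [p], hence so does
   [F(X^k)] for all [k = 1 + i r] and a suitable [r]; a Vandermonde argument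
   then yields an annihilator [prod_v (X^(r u) - X^(r v))].
   Over the complex numbers they are also killed by the product of the
   [f_D - t], [t] an eigenvalue of [B].  For each pair of factors, a function
   killed by [f_D - t] and [X^v - w] satisfies a linear recurrence across the
   direction [v], nontrivial because [X^v - w] does not divide [f_D - t].
   Therefore the functions killed by both products are determined by their
   restriction to a finite window, and the pigeonhole principle gives periods in
   both coordinate directions. *)

From HB Require Import structures.
Require Import Defs.
From mathcomp Require Import all_boot all_order all_algebra.
From mathcomp Require Import finmap complex reals.
From mathcomp.multinomials Require Import monalg.
From mathcomp Require Import zify ring.

Set Implicit Arguments.
Unset Strict Implicit.
Unset Printing Implicit Defensive.

Import Order.TTheory GRing.Theory Num.Theory.
Local Open Scope ring_scope.

(** * Finite determination *)

Section LocalOperators.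
Variable K : comNzRingType.
Implicit Types (l m : seq (K * Z2)) (ls : seq (seq (K * Z2))) (h : Z2 -> K).

(** A pair [(a, u)] stands for a times translation by u; products of Laurent polynomials become
    compositions of operators. *)
Definition lop l h : Z2 -> K := fun z => \sum_(t <- l) t.1 * h (z + t.2).
Definition lops ls h : Z2 -> K := foldr lop h ls.
Definition killed l h : Prop := forall z, lop l h z = 0.
Definition killeds ls h : Prop := forall z, lops ls h z = 0.

(** Meant for linear spaces of functions, where testing for zero suffices to compare two members. *)
Definition determined (P : (Z2 -> K) -> Prop) : Prop :=
  exists W : seq Z2, forall h, P h -> (forall w, w \in W -> h w = 0) ->
  forall z, h z = 0.

Lemma eq_lop l h h' : h =1 h' -> lop l h =1 lop l h'.
Proof. by move=> e z; apply: eq_bigr => t _; rewrite e. Qed.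

Lemma lop0 l h : (forall z, h z = 0) -> killed l h.
Proof. by move=> h0 z; rewrite /lop big1 // => t _; rewrite h0 mulr0. Qed.

Lemma lopC l m h : lop l (lop m h) =1 lop m (lop l h).
Proof.
move=> z; rewrite /lop.
under eq_bigr do rewrite mulr_sumr.
rewrite exchange_big; apply: eq_bigr => s _ /=.
rewrite mulr_sumr; apply: eq_bigr => t _.
by rewrite mulrCA addrAC.
Qed.

Lemma lopsC ls m h : lops ls (lop m h) =1 lop m (lops ls h).
Proof.
elim: ls => [|l ls IH] z //=.
by rewrite (eq_lop l IH) lopC.
Qed.

Lemma killed_lop l m h : killed l h -> killed l (lop m h).
Proof. by move=> lh z; rewrite lopC lop0. Qed.

Lemma killeds_lop ls m h : killeds ls h -> killeds ls (lop m h).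
Proof. by move=> lh z; rewrite lopsC lop0. Qed.

Lemma determined_sub (P Q : (Z2 -> K) -> Prop) :
  (forall h, P h -> Q h) -> determined Q -> determined P.
Proof. by move=> PQ [W HW]; exists W => h /PQ; apply: HW. Qed.

(** If the whole composition kills [h], then [lop l h] is killed by the remaining operators, and it
    vanishes on their window once [h] vanishes on that window translated by the offsets in [l]. So
    [l] kills [h], and the window of [l] applies. *)
Lemma determined_lops (P : (Z2 -> K) -> Prop) ls :
    (forall m h, P h -> P (lop m h)) ->
    (forall l, l \in ls -> determined (fun h => P h /\ killed l h)) ->
  determined (fun h => P h /\ killeds ls h).
Proof.
move=> Plop; elim: ls => [|l ls IH] det.
  by exists [::] => h [_ h0] _ z; apply: h0.
have [|W2 HW2] := IH; first by move=> m mls; apply: det; rewrite inE mls orbT.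
have [|W1 HW1] := det l; first by rewrite inE eqxx.
exists (W1 ++ [seq w + t.2 | w <- W2, t <- l]) => h [Ph lh] hW.
have hW1 : forall w, w \in W1 -> h w = 0.
  by move=> w wW; apply: hW; rewrite mem_cat wW.
apply: HW1 => //; split=> //.
apply: HW2; first by split; [exact: Plop | move=> z; rewrite lopsC; apply: lh].
move=> w wW; rewrite /lop big_seq big1 // => t tl.
by rewrite hW ?mulr0 // mem_cat (allpairs_f (fun w (t : K * Z2) => w + t.2)) ?orbT.
Qed.

Lemma determined_lops2 ls ms :
    (forall l m, l \in ls -> m \in ms ->
      determined (fun h => killed l h /\ killed m h)) ->
  determined (fun h => killeds ls h /\ killeds ms h).
Proof.
move=> det; apply: determined_lops => [m h|m mms]; first exact: killeds_lop.
apply: (@determined_sub _ (fun h => killed m h /\ killeds ls h)).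
  by move=> h [].
apply: determined_lops => [l h|l lls]; first exact: killed_lop.
by apply: determined_sub (det l m lls mms) => h [].
Qed.

End LocalOperators.

(** * Recurrences and binomial divisors *)

(** The leading coefficient of [p] propagates zeros to the right of the window, and a nonzero
    constant coefficient propagates them to the left. A factor X of [p] only translates the
    recurrence. *)
Lemma recurrence_eq0 (K : idomainType) (p : {poly K}) (H : int -> K) :
    p != 0 -> (forall z : int, \sum_(i < size p) p`_i * H (z + i%:Z) = 0) ->
    (forall i : nat, (i < size p)%N -> H i%:Z = 0) ->
  forall z, H z = 0.
Proof.
elim/poly_ind: p => [|p c IH]; first by rewrite eqxx.
have [-> nz0|c0 _] := eqVneq c 0.
  rewrite addr0 in nz0 *.
  have p0 : p != 0 by apply: contraNneq nz0 => ->; rewrite mul0r.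
  rewrite size_mulX // => rec win; apply: IH => // [z|i ip]; last first.
    by apply: win; apply: ltnW.
  apply: etrans (rec (z - 1)); rewrite big_ord_recl coefMX /= mul0r add0r.
  apply: eq_bigr => i _; rewrite coefMX /=; congr (_ * H _).
  by rewrite /bump /=; lia.
set q := p * 'X + c%:P => rec win.
have q0c : q`_0 = c by rewrite /q coefD coefMX coefC add0r.
have q0 : q != 0 by apply: contraNneq c0 => q0; rewrite -q0c q0 coef0.
clearbody q; have sq : (0 < size q)%N by rewrite size_poly_gt0.
have pos (m : nat) : H m%:Z = 0.
  elim/ltn_ind: m => m IHm.
  have [mq|qm] := ltnP m (size q); first exact: win.
  have := rec (m%:Z - (size q).-1%:Z).
  rewrite -(ltn_predK sq) big_ord_recr /= big1 => [|i _].
    rewrite add0r subrK => /eqP; rewrite mulf_eq0 => /orP[/eqP lq0|/eqP //].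
    by case/negP: q0; rewrite -lead_coef_eq0 lead_coefE lq0.
  have -> : (m%:Z - (size q).-1%:Z + i%:Z = (m - (size q).-1 + i)%N%:Z).
    lia.
  by rewrite IHm ?mulr0 // -ltn_subRL subKn ?ltn_ord // (leq_trans (leq_pred _)).
have neg (m : nat) : H (- m%:Z) = 0.
  elim/ltn_ind: m => m IHm.
  have := rec (- m%:Z).
  rewrite -(ltn_predK sq) big_ord_recl /= big1 => [|i _].
    by rewrite !addr0 q0c => /eqP; rewrite mulf_eq0 (negPf c0) => /eqP.
  rewrite /bump /= add1n; have [im|mi] := ltnP i m.
    have -> : - m%:Z + i.+1%:Z = - (m - i.+1)%N%:Z by lia.
    by rewrite IHm ?mulr0 //; lia.
  have -> : - m%:Z + i.+1%:Z = (i.+1 - m)%N%:Z by lia.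
  by rewrite pos mulr0.
by move=> [m|m]; [apply: pos | rewrite NegzE; apply: neg].
Qed.

Section LineFactors.
Variable K : fieldType.
Implicit Types (p q r : laurent K) (u v w z : Z2).

Lemma coeff_lmul p q z :
  (lmul p q)@_z = \sum_(u <- msupp p) p@_u * q@_(z - u).
Proof.
rewrite /lmul raddf_sum /=; apply: eq_bigr => u _.
rewrite raddf_sum /= [q in RHS]monalgE raddf_sum mulr_sumr /=.
apply: eq_bigr => v _; rewrite !mcoeffU -mulrnAr; congr (_ * (_ *+ nat_of_bool _)).
by rewrite [RHS]eq_sym subr_eq eq_sym addrC.
Qed.

(* Rewriting with the general [mcoeff] lemmas leaves terms on which unification
   diverges; these instances do not. *)
Lemma coeffD p q z : (p + q)@_z = p@_z + q@_z.
Proof. exact: mcoeffD. Qed.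

Lemma coeffB p q z : (p - q)@_z = p@_z - q@_z.
Proof. exact: mcoeffB. Qed.

Lemma coeffZ p (a : K) z : (a *: p)@_z = a * p@_z.
Proof. exact: mcoeffZ. Qed.

Lemma coeffU (a : K) v z : (<< a *g v >> : laurent K)@_z = a * (z == v)%:R.
Proof. by rewrite mcoeffU mulr_natr eq_sym. Qed.

Lemma ldvdP p q :
  ldvd p q <-> exists r, forall z, q@_z = \sum_(u <- msupp p) p@_u * r@_(z - u).
Proof.
split=> -[r qr]; exists r; first by move=> z; rewrite qr coeff_lmul.
by apply/malgP => z; rewrite qr coeff_lmul.
Qed.

Lemma ldvd_lin p q r (a : K) : ldvd p q -> ldvd p r -> ldvd p (q + a *: r).
Proof.
move=> /ldvdP[q' qE] /ldvdP[r' rE]; apply/ldvdP; exists (q' + a *: r') => z.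
rewrite coeffD coeffZ qE rE mulr_sumr -big_split /=.
by apply: eq_bigr => u _; rewrite coeffD coeffZ mulrDr mulrCA.
Qed.

Lemma ldvd0 p : ldvd p 0.
Proof.
apply/ldvdP; exists 0 => z; rewrite mcoeff0 big1 // => u _.
by rewrite mcoeff0 mulr0.
Qed.

Lemma ldvdZ p q (a : K) : ldvd p q -> ldvd p (a *: q).
Proof. by move=> pq; have := ldvd_lin a (ldvd0 p) pq; rewrite add0r. Qed.

Lemma ldvdD p q r : ldvd p q -> ldvd p r -> ldvd p (q + r).
Proof. by move=> pq pr; have := ldvd_lin 1 pq pr; rewrite scale1r. Qed.

Lemma ldvd_sum p (I : eqType) (s : seq I) (F : I -> laurent K) :
  (forall i, ldvd p (F i)) -> ldvd p (\sum_(i <- s) F i).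
Proof. by move=> dv; apply: big_ind => //; [exact: ldvd0 | exact: ldvdD]. Qed.

Definition binom v (t : K) : laurent K := << 1 *g v >> - << t *g 0 >>.

Lemma msupp_binom v t : v != 0 -> t != 0 -> msupp (binom v t) = [fset v; 0]%fset.
Proof.
move=> v0 t0; apply/fsetP => z; rewrite -mcoeff_neq0 coeffB !coeffU !inE mul1r.
have [->|vz] /= := eqVneq z v.
  by rewrite (negPf v0) mulr0 subr0 oner_eq0.
by rewrite sub0r oppr_eq0; case: (z == 0); rewrite ?mulr1 ?mulr0 ?t0 ?eqxx.
Qed.

Lemma line_binom v t : v != 0 -> t != 0 -> line_poly (binom v t).
Proof.
move=> v0 t0; rewrite /line_poly msupp_binom //; split.
  by rewrite cardfs2 v0.
exists (- v.2), v.1, 0; split=> [|u].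
  by apply: contraNneq v0 => -[/eqP]; rewrite oppr_eq0; case: v => a b /= /eqP -> ->.
by rewrite !inE => /orP[] /eqP-> /=; rewrite ?mulr0 ?addr0 // mulNr mulrC addNr.
Qed.

Lemma ldvd_binomP v t q r : v != 0 -> t != 0 ->
  (forall z, q@_z = r@_(z - v) - t * r@_z) -> ldvd (binom v t) q.
Proof.
move=> v0 t0 qr; apply/ldvdP; exists r => z; rewrite qr.
rewrite msupp_binom // big_fsetU1 ?inE //= big_seq_fset1 !coeffB !coeffU.
rewrite !eqxx [0 == v]eq_sym (negPf v0) !mulr0 !mulr1 subr0 sub0r.
by rewrite mul1r subr0 mulNr.
Qed.

(** This is X^z (X^(j v) - t^j), for [j] of either sign: the error made when X^v is replaced by
    t. *)
Definition binom_shift v t z (j : int) : laurent K :=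
  << 1 *g z + v *~ j >> - << t ^ j *g z >>.

Lemma coeff_binom_shift v t z j x :
  (binom_shift v t z j)@_x = (x == z + v *~ j)%:R - t ^ j * (x == z)%:R.
Proof. by rewrite coeffB !coeffU mul1r. Qed.

Lemma ldvd_binom_shift v t z j : v != 0 -> t != 0 ->
  ldvd (binom v t) (binom_shift v t z j).
Proof.
move=> v0 t0.
(* This combination equals X^(z + k v) (X^v - t). Descending to negative [k] also requires dividing
   by [t]. *)
have dvS k : ldvd (binom v t) (binom_shift v t z (k + 1) - t *: binom_shift v t z k).
  move: (binom_shift v t z (k + 1)) (coeff_binom_shift v t z (k + 1)) => A EA.
  move: (binom_shift v t z k) (coeff_binom_shift v t z k) => B EB.
  apply: (@ldvd_binomP _ _ _ << 1 *g z + v *~ k >>) => // x.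
  rewrite coeffB coeffZ EA EB !coeffU.
  have <- : (x - v == z + v *~ k) = (x == z + v *~ (k + 1)).
    by rewrite mulrzDr mulr1z addrA subr_eq.
  rewrite expfzDr // expr1z; ring.
elim/int_ind: j => [|n IH|n IH].
- by rewrite /binom_shift mulr0z addr0 expr0z subrr; exact: ldvd0.
- have := ldvd_lin t (dvS n) IH.
  by rewrite subrK -PoszD addn1.
have := dvS (- n.+1%:Z).
have -> : - n.+1%:Z + 1 = - n%:Z by lia.
move: (binom_shift v t z (- n.+1%:Z)) (binom_shift v t z (- n%:Z)) IH => A B.
move=> /ldvdP[b bE] /ldvdP[a aE].
apply/ldvdP; exists (t^-1 *: (b - a)) => x; move: (aE x) (bE x).
rewrite (coeffB B) (coeffZ A) => aEx bEx.
apply: (mulfI t0); rewrite -[t * _](subKr B@_x) aEx bEx -sumrB mulr_sumr.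
by apply: eq_bigr => u _; rewrite coeffZ coeffB; field.
Qed.

Lemma sum_coef_scale (V : lmodType K) (I : eqType) (s : seq I) (a : I -> K)
    (e : I -> nat) (g : nat -> V) (p := \sum_(k <- s) a k *: 'X^(e k) : {poly K}) :
  \sum_(i < size p) p`_i *: g i = \sum_(k <- s) a k *: g (e k).
Proof.
pose N := (size p + \max_(k <- s) (e k).+1)%N.
have eN k : k \in s -> (e k < N)%N.
  by move=> ks; rewrite ltn_addl // (@leq_bigmax_seq _ _ _ (fun k => (e k).+1)).
rewrite (big_ord_widen N (fun i => p`_i *: g i)) ?leq_addr // big_mkcond /=.
transitivity (\sum_(i < N) \sum_(k <- s) (a k *+ (i == e k :> nat)) *: g i).
  apply: eq_bigr => i _; rewrite -scaler_suml.
  have -> : \sum_(k <- s) a k *+ (i == e k :> nat) = p`_i.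
    rewrite coef_sum; apply: eq_bigr => k _.
    by rewrite coefZ coefXn mulr_natr.
  by case: ltnP => // pi; rewrite nth_default // scale0r.
rewrite exchange_big big_seq [RHS]big_seq; apply: eq_bigr => k ks.
rewrite (bigD1 (Ordinal (eN k ks))) //= eqxx mulr1n big1 ?addr0 // => i.
by rewrite -val_eqE /= => /negPf ->; rewrite mulr0n scale0r.
Qed.

End LineFactors.

Lemma mulrz_pair (u : Z2) (n : int) : u *~ n = (u.1 * n, u.2 * n).
Proof.
elim/int_ind: n => [|n IH|n IH]; first by rewrite mulr0z !mulr0.
  by rewrite intS addrC mulrzDr mulr1z IH; congr (_, _); rewrite /= mulrDr mulr1.
have -> : - n.+1%:Z = - n%:Z - 1 by lia.
by rewrite mulrzBr mulr1z IH; congr (_, _); rewrite /= mulrBr mulr1.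
Qed.

(** * Laurent polynomials as operators, and recurrences across a direction *)

Section LaurentOperators.
Variable K : fieldType.
Implicit Types (q : laurent K) (u v z : Z2) (h : Z2 -> K).

(** The exponent u acts as translation by -u, as in the product of [q] with the formal series of a
    function; hence X^(-d) in the shape polynomial reads the value at z + d. *)
Definition laurent_op q : seq (K * Z2) := [seq (q@_u, - u) | u <- msupp q].
Definition shift_op v (t : K) : seq (K * Z2) := [:: (1, v); (- t, 0)].

Lemma lop_laurent q h z :
  lop (laurent_op q) h z = \sum_(u <- msupp q) q@_u * h (z - u).
Proof. by rewrite /lop big_map. Qed.

Lemma lop_shift v t h z : lop (shift_op v t) h z = h (z + v) - t * h z.
Proof. by rewrite /lop !big_cons big_nil /= addr0 addr0 mul1r mulNr. Qed.

Lemma killed_shift v t h : t != 0 -> killed (shift_op v t) h ->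
  forall z (j : int), h (z + v *~ j) = t ^ j * h z.
Proof.
move=> t0 hv z j.
have step k : h (z + v *~ (k + 1)) = t * h (z + v *~ k).
  have := hv (z + v *~ k); rewrite lop_shift => /eqP; rewrite subr_eq0 => /eqP <-.
  by rewrite mulrzDr mulr1z addrA.
elim/int_ind: j => [|n IH|n IH].
- by rewrite mulr0z addr0 expr0z mul1r.
- by rewrite -addn1 PoszD step IH mulrA expfzDr // expr1z [t * _]mulrC.
have := step (- n.+1%:Z).
have -> : - n.+1%:Z + 1 = - n%:Z by lia.
rewrite IH => E; apply: (mulfI t0); rewrite -E mulrA; congr (_ * _).
by rewrite -{2}[t]expr1z -expfzDr //; congr (_ ^ _); lia.
Qed.

(** Complete [v] to a basis of Z^2 by [w]. The relation h(z + v) = t h(z) reduces h to its values at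
    the multiples of [w], where [q] becomes a one-variable recurrence [p]. It is nontrivial, since
    [p = 0] would make X^v - 1/t a divisor of [q]. *)
Lemma determined_primitive q v (t : K) : gcdz v.1 v.2 = 1 -> t != 0 ->
    ~ has_line_factor q ->
  determined (fun h => killed (laurent_op q) h /\ killed (shift_op v t) h).
Proof.
move=> cv t0 nq.
have v0 : v != 0 by apply/eqP => v0; move: cv; rewrite v0 gcdz0.
have [r [s bez]] := Bezoutz v.1 v.2; rewrite cv in bez.
(* By Bezout, [w] and [v] have determinant -1; [k u] and [j u] are the coordinates of [u] in this
   basis. *)
pose w : Z2 := (- s, r).
pose j (u : Z2) := r * u.1 + s * u.2; pose k (u : Z2) := v.1 * u.2 - v.2 * u.1.
have dec u : u = w *~ k u + v *~ j u.
  rewrite !mulrz_pair /w /j /k; case: u => x y; congr (_, _) => /=.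
    rewrite -[LHS]mul1r -bez; ring.
  rewrite -[LHS]mul1r -bez; ring.
pose M := \max_(u <- msupp q) `|k u|%N.
pose e u := `|M%:Z - k u|%N.
have eE u : u \in msupp q -> (e u)%:Z = M%:Z - k u.
  move=> uq; have : (`|k u| <= M)%N.
    by apply: (@leq_bigmax_seq _ _ _ (fun u => `|k u|%N)).
  rewrite /e; lia.
(* Since u = k w + j v, the value h(z - u) is t^(-j) h(z - k w). *)
pose a u := q@_u * t ^ (- j u).
pose p : {poly K} := \sum_(u <- msupp q) a u *: 'X^(e u).
have sumE (g : int -> K) (y : int) : \sum_(i < size p) p`_i * g (y + i%:Z) =
    \sum_(u <- msupp q) a u * g (y + M%:Z - k u).
  rewrite -[LHS]/(\sum_(i < size p) p`_i *: (g (y + i%:Z) : K^o)).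
  rewrite (sum_coef_scale _ _ _ (fun i => g (y + i%:Z) : K^o)).
  rewrite big_seq [RHS]big_seq; apply: eq_bigr => u uq.
  by rewrite eE // addrA.
have [p0|p0] := eqVneq p 0.
  case: nq; exists (binom v t^-1); first by apply: line_binom; rewrite ?invr_eq0.
  (* Modulo X^v = 1/t the monomial X^u becomes t^(-j) X^(k w). Collected by [k], these remainders
     have the coefficients of [p], so they cancel. *)
  suff -> : q = \sum_(u <- msupp q) q@_u *: binom_shift v t^-1 (w *~ k u) (j u).
    by apply: ldvd_sum => u; apply/ldvdZ/ldvd_binom_shift; rewrite ?invr_eq0.
  apply/malgP => x; rewrite raddf_sum /=.
  under eq_bigr do rewrite coeffZ coeff_binom_shift -dec mulrBr.
  rewrite sumrB [X in _ - X](_ : _ = 0) ?subr0.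
    rewrite {1}[q]monalgE raddf_sum /=; apply: eq_bigr => u _.
    by rewrite coeffU.
  have := sumE (fun i => (x == w *~ (- i + M%:Z))%:R) 0.
  rewrite p0 size_poly0 big_ord0 => /esym; apply: etrans; apply: eq_bigr => u _.
  rewrite /a exprz_inv mulrA; congr (_ * (x == w *~ _)%:R); ring.
exists [seq w *~ i%:Z | i <- iota 0 (size p)] => h [qh vh] hW.
have H0 : forall y : int, h (w *~ y) = 0.
  apply: (recurrence_eq0 p0) => [y|i ip]; last first.
    by apply/hW/map_f; rewrite mem_iota.
  rewrite (sumE (fun y => h (w *~ y))); apply: etrans (qh (w *~ (y + M%:Z))).
  rewrite lop_laurent; apply: eq_bigr => u _; rewrite /a -mulrA; congr (_ * _).
  rewrite -(killed_shift t0 vh); congr h.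
  by rewrite mulrzDr !mulrNz -addrA -opprD -dec.
move=> z; rewrite (dec z) (killed_shift t0 vh) H0 mulr0 //.
Qed.

End LaurentOperators.

Lemma lops_shift (K : fieldType) (v : Z2) (rs : seq K) (h : Z2 -> K) (z : Z2) :
  lops [seq shift_op v t | t <- rs] h z =
  \sum_(i < (size rs).+1) (\prod_(t <- rs) ('X - t%:P))`_i * h (z + v *~ i%:Z).
Proof.
elim: rs z => [|t rs IH] z.
  by rewrite big_nil big_ord1 coefC mul1r mulr0z addr0.
rewrite big_cons; set P := \prod_(t <- rs) _ in IH *.
have sP : (size P <= (size rs).+1)%N by rewrite size_prod_XsubC.
transitivity (\sum_(i < (size rs).+2) ((if i == 0 :> nat then 0 else P`_i.-1) -
    t * P`_i) * h (z + v *~ i%:Z)); last first.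
  by apply: eq_bigr => i _; rewrite [in RHS]mulrBl coefB coefXM coefCM.
under eq_bigr do rewrite mulrBl; rewrite sumrB.
rewrite big_ord_recl [X in _ - X]big_ord_recr /= mul0r add0r.
rewrite [P`_(size rs).+1]nth_default // mulr0 mul0r addr0.
rewrite lop_shift !IH mulr_sumr; congr (_ - _); apply: eq_bigr => i _.
  rewrite /bump /= add1n -addrA; congr (_ * h (z + _)).
  by rewrite intS mulrzDr mulr1z.
by rewrite mulrA.
Qed.

(** Write v = d v' with v' primitive, and let T be the translation by v'. Over an algebraically
    closed field T^d - 1 splits into factors T - t with t nonzero, and the primitive case applies to
    each. *)
Lemma determined_translate (K : closedFieldType) (q : laurent K) (v : Z2) :
    v != 0 -> ~ has_line_factor q ->
  determined (fun h => killed (laurent_op q) h /\ forall z, h (z + v) = h z).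
Proof.
move=> v0 nq; pose d := `|gcdz v.1 v.2|%N.
have dE : d%:Z = gcdz v.1 v.2 by rewrite /d /gcdz absz_nat.
have d0 : (0 < d)%N.
  rewrite lt0n -eqz_nat dE gcdz_eq0; apply: contraNN v0.
  by rewrite {3}[v]surjective_pairing => /andP[/eqP-> /eqP->].
pose v' : Z2 := ((v.1 %/ d%:Z)%Z, (v.2 %/ d%:Z)%Z).
have vE : v = v' *~ d%:Z.
  by rewrite mulrz_pair /v' /= !divzK ?dE ?dvdz_gcdl ?dvdz_gcdr //
    -surjective_pairing.
have cv' : gcdz v'.1 v'.2 = 1.
  have /(@mulIf _ d%:Z) : d%:Z != 0 by rewrite eqz_nat -lt0n.
  apply; have := mulz_gcdl v'.1 v'.2 d; rewrite absz_nat /= => ->.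
  by rewrite !divzK ?mul1r ?dE ?dvdz_gcdl ?dvdz_gcdr.
have [rs] := closed_field_poly_normal ('X^d - 1 : {poly K}).
have monX : 'X^d - 1%:P \is @monic K by rewrite monicXnsubC.
rewrite polyC1 in monX; rewrite (monicP monX) scale1r => rsE.
have srs : size rs = d.
  by apply: succn_inj; rewrite -(size_prod_XsubC rs id) -rsE -polyC1 size_XnsubC.
apply: (@determined_sub _ _ (fun h => killed (laurent_op q) h /\
  killeds [seq shift_op v' t | t <- rs] h)).
  move=> h [qh vh]; split=> // z; rewrite lops_shift -rsE srs.
  rewrite big_ord_recr (bigD1 (Ordinal d0)) //= big1 => [|i].
    rewrite !coefB !coefXn !coef1 eqxx -vE vh mulr0z !addr0.
    by rewrite eq_sym (gtn_eqF d0) !eqxx /=; ring.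
  rewrite -val_eqE /= coefB coefXn coef1 => /negPf->.
  by rewrite (ltn_eqF (ltn_ord i)) subrr mul0r.
apply: determined_lops => [m h|l /mapP[t trs ->]]; first exact: killed_lop.
apply: determined_primitive => //; apply: contraTneq trs => ->.
rewrite -root_prod_XsubC -rsE rootE !hornerE expr0n.
by rewrite -[d]prednK // sub0r oppr_eq0 oner_eq0.
Qed.

(** * Integral polynomials acting on functions, and dilation *)

(* The outer variable is the second coordinate: [P`_i`_j] is the coefficient of
   the monomial with exponent [(j, i)]. *)
Local Notation A := {poly {poly int}}.

Definition emb (u : nat * nat) : Z2 := (u.1%:Z, u.2%:Z).
Definition mono (u : nat * nat) : A := 'X^(u.1)%:P * 'X^(u.2).
Definition cst (c : int) : A := c%:P%:P.

Lemma embD u v : emb (u + v) = emb u + emb v.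
Proof. by []. Qed.

Lemma mono_add u v : mono (u + v) = mono u * mono v.
Proof. by rewrite /mono !exprD polyCM mulrACA. Qed.

Lemma mono_exp u k : mono u ^+ k = mono (u *+ k).
Proof.
elim: k => [|k IH]; first by rewrite expr0 mulr0n /mono !expr0 mulr1.
by rewrite exprS IH mulrS mono_add.
Qed.

Lemma coef_mono u i j : (mono u)`_i`_j = ((i == u.2) && (j == u.1))%:R.
Proof.
rewrite /mono coefCM coefXn; case: (i == u.2); last by rewrite mulr0 coef0.
by rewrite mulr1 coefXn.
Qed.

Lemma coef_cst_mono c u i j :
  (cst c * mono u)`_i`_j = c * ((i == u.2) && (j == u.1))%:R.
Proof. by rewrite /cst coefCM coefCM coef_mono. Qed.

Definition grid (P : A) := maxn (size P) (sizeY P).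

Lemma grid_out P i j : ~~ ((i < grid P) && (j < grid P))%N -> P`_i`_j = 0.
Proof.
rewrite negb_and -!leqNgt => /orP[gi|gj].
  by rewrite [P`_i]nth_default ?coef0 // (leq_trans (leq_maxl _ _) gi).
rewrite nth_default // (leq_trans (max_size_coefXY _ _)) //.
exact: leq_trans (leq_maxr _ _) gj.
Qed.

(** Here the exponent u acts as translation by +u, opposite to [laurent_op]. *)
Definition act (P : A) (h : Z2 -> int) (z : Z2) : int :=
  \sum_(i < grid P) \sum_(j < grid P) P`_i`_j * h (z + emb (val j, val i)).

Lemma sum_square_widen (V : nmodType) (F : nat -> nat -> V) n N : (n <= N)%N ->
    (forall i j, ~~ ((i < n) && (j < n))%N -> F i j = 0) ->
  \sum_(i < n) \sum_(j < n) F i j = \sum_(i < N) \sum_(j < N) F i j.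
Proof.
move=> nN F0; rewrite (big_ord_widen N (fun i => \sum_(j < n) F i j)) //.
rewrite big_mkcond; apply: eq_bigr => i _.
rewrite (big_ord_widen N (F i)) // big_mkcond.
case: ifP => ni; last by rewrite big1 // => j _; rewrite F0 // ni.
by apply: eq_bigr => j _; case: ifP => // nj; rewrite F0 // nj andbF.
Qed.

Lemma act_widen N P h z : (grid P <= N)%N ->
  act P h z = \sum_(i < N) \sum_(j < N) P`_i`_j * h (z + emb (val j, val i)).
Proof.
move=> PN; rewrite /act.
rewrite (@sum_square_widen _ (fun i j => P`_i`_j * h (z + emb (j, i))) _ _ PN) //.
by move=> i j /grid_out->; rewrite mul0r.
Qed.

Lemma poly2_sum P :
  P = \sum_(i < grid P) \sum_(j < grid P) cst P`_i`_j * mono (val j, val i).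
Proof.
apply/polyP => i; apply/polyP => j; rewrite coef_sum coef_sum.
under eq_bigr => i' _ do (rewrite coef_sum coef_sum;
  under eq_bigr => j' _ do rewrite coef_cst_mono /=).
have [/andP[gi gj]|/grid_out Pij] := boolP ((i < grid P) && (j < grid P))%N.
  rewrite (bigD1 (Ordinal gi)) //= (bigD1 (Ordinal gj)) //= !eqxx mulr1.
  rewrite big1 => [|j' /negPf]; last by rewrite -val_eqE /= eq_sym => ->; rewrite mulr0.
  rewrite big1 ?addr0 // => i' /negPf; rewrite -val_eqE /= eq_sym => ->.
  by rewrite big1 // => j' _; rewrite mulr0.
rewrite Pij big1 // => i' _; rewrite big1 // => j' _.
by case: andP => [[/eqP <- /eqP <-]|_]; rewrite ?mulr0 // Pij mul0r.
Qed.

Lemma poly2_ind (Q : A -> Prop) : Q 0 -> (forall P P', Q P -> Q P' -> Q (P + P')) ->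
  (forall c u, Q (cst c * mono u)) -> forall P, Q P.
Proof.
move=> Q0 QD Qm P; rewrite [P]poly2_sum.
by apply: big_ind => // i _; apply: big_ind.
Qed.

Lemma act0 h z : act 0 h z = 0.
Proof.
by rewrite /act big1 // => i _; rewrite big1 // => j _; rewrite !coef0 mul0r.
Qed.

Lemma actD P Q h z : act (P + Q) h z = act P h z + act Q h z.
Proof.
pose N := maxn (grid (P + Q)) (maxn (grid P) (grid Q)).
rewrite (@act_widen N) ?leq_maxl // (@act_widen N P) ?(@act_widen N Q); try lia.
rewrite -big_split; apply: eq_bigr => i _.
by rewrite -big_split; apply: eq_bigr => j _; rewrite !coefD mulrDl.
Qed.

Lemma act_mono c u h z : act (cst c * mono u) h z = c * h (z + emb u).
Proof.
have [u1 u2] : (u.2 < maxn (grid (cst c * mono u)) (maxn u.1 u.2).+1)%N /\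
    (u.1 < maxn (grid (cst c * mono u)) (maxn u.1 u.2).+1)%N by lia.
rewrite (@act_widen (maxn (grid (cst c * mono u)) (maxn u.1 u.2).+1)) ?leq_maxl //.
rewrite (bigD1 (Ordinal u1)) //= [X in X + _](bigD1 (Ordinal u2)) //=.
rewrite coef_cst_mono !eqxx mulr1.
rewrite -surjective_pairing big1 ?addr0 => [|j]; last first.
  by rewrite -val_eqE coef_cst_mono /= => /negPf->; rewrite andbF mulr0 mul0r.
rewrite big1 ?addr0 // => i; rewrite -val_eqE /= => /negPf iu.
by rewrite big1 // => j _; rewrite coef_cst_mono iu mulr0 mul0r.
Qed.

Lemma act_sum (I : Type) (s : seq I) (F : I -> A) h z :
  act (\sum_(i <- s) F i) h z = \sum_(i <- s) act (F i) h z.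
Proof. by apply: (big_morph (fun P => act P h z)) => [P Q|]; rewrite ?actD ?act0. Qed.

Lemma actM P Q h z : act (P * Q) h z = act P (act Q h) z.
Proof.
elim/poly2_ind: P => [|P P' IH IH'|c u]; first by rewrite mul0r !act0.
  by rewrite mulrDl !actD IH IH'.
rewrite act_mono; elim/poly2_ind: Q => [|Q Q' IH IH'|d v].
- by rewrite mulr0 !act0 mulr0.
- by rewrite mulrDr !actD IH IH' mulrDr.
rewrite mulrACA -mono_add /cst -!polyCM -/(cst _) !act_mono.
by rewrite embD addrA mulrA.
Qed.

Lemma act_fun0 P h z : (forall z, h z = 0) -> act P h z = 0.
Proof.
by move=> h0; rewrite /act big1 // => i _; rewrite big1 // => j _; rewrite h0 mulr0.
Qed.

Lemma act_fun_sum (I : Type) (s : seq I) (h : I -> Z2 -> int) P z :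
  act P (fun z => \sum_(k <- s) h k z) z = \sum_(k <- s) act P (h k) z.
Proof.
elim/poly2_ind: P => [|P P' IH IH'|c u].
- by rewrite act0 big1 // => k _; rewrite act0.
- by rewrite actD IH IH' -big_split; apply: eq_bigr => k _; rewrite actD.
by rewrite act_mono mulr_sumr; apply: eq_bigr => k _; rewrite act_mono.
Qed.

(** The substitution P(X) -> P(X^k) in both variables, written as a composite of ring morphisms so
    that it inherits their structure. *)
Definition dilate (k : nat) : A -> A :=
  comp_poly 'X^k \o map_poly (comp_poly 'X^k).
HB.instance Definition _ k := GRing.RMorphism.on (dilate k).

Lemma dilate_cst k c : dilate k (cst c) = cst c.
Proof. by rewrite /dilate /cst /= map_polyC /= !comp_polyC. Qed.

Lemma mulrn_nat_pair (u : nat * nat) k : u *+ k = ((u.1 * k)%N, (u.2 * k)%N).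
Proof.
elim: k => [|k IH]; first by rewrite mulr0n !muln0.
by rewrite mulrS IH !mulnS.
Qed.

Lemma dilate_mono k u : dilate k (mono u) = mono (u *+ k).
Proof.
rewrite /mono rmorphM /= /dilate /= map_polyC map_polyXn /= comp_polyC.
by rewrite !comp_Xn_poly -!exprM ![(k * _)%N]mulnC mulrn_nat_pair.
Qed.

Lemma dilate_term k c u : dilate k (cst c * mono u) = cst c * mono (u *+ k).
Proof. by rewrite rmorphM /= dilate_cst dilate_mono. Qed.

Lemma dilate1 P : dilate 1 P = P.
Proof.
elim/poly2_ind: P => [|P P' IH IH'|c u]; first by rewrite rmorph0.
  by rewrite rmorphD /= IH IH'.
by rewrite dilate_term.
Qed.

Lemma dilate_comp k l P : dilate k (dilate l P) = dilate (l * k) P.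
Proof.
elim/poly2_ind: P => [|P P' IH IH'|c u]; first by rewrite !rmorph0.
  by rewrite !rmorphD /= IH IH'.
by rewrite !dilate_term mulrnA.
Qed.

(** * Frobenius congruence and dilated annihilators *)

Lemma prime_expD (R : comNzRingType) p (a b : R) : prime p ->
  exists e, (a + b) ^+ p = a ^+ p + b ^+ p + e *+ p.
Proof.
move=> pp; case: p pp => [//|[//|p]] pp; set q := p.+2 in pp *.
exists (\sum_(i < p.+1) a ^+ (q - i.+1) * b ^+ i.+1 *+ ('C(q, i.+1) %/ q)).
rewrite exprDn big_ord_recl big_ord_recr /= /bump /= add1n subn0 subnn.
rewrite !expr0 mulr1 mul1r bin0 binn !mulr1n -addrA; congr (_ + _).
rewrite addrC; congr (_ + _).
rewrite -sumrMnl; apply: eq_bigr => i _; rewrite /bump /= add1n -mulrnA divnK //.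
by apply: prime_dvd_bin => //; exact: (ltn_ord i).
Qed.

Lemma int_fermat p (c : int) : prime p -> exists e : int, c ^+ p = c + e *+ p.
Proof.
move=> pp; have p0 : p%:Z != 0 by rewrite eqz_nat -lt0n prime_gt0.
suff /eqP : (c ^+ p = c %[mod p])%Z.
  rewrite eqz_mod_dvd => /dvdzP[e eE]; exists e.
  by rewrite -mulr_natr -[p%:R]/(p%:R) natz -eE addrC subrK.
rewrite -modzXm; case: (c %% p)%Z (modz_ge0 c p0) (modz_mod c p) => // a _ aE.
have -> : a%:Z ^+ p = (a ^ p)%N%:Z by rewrite -natz -natrX natz.
by rewrite -[RHS]aE !modz_nat; congr Posz; exact: fermat_little.
Qed.

(** Modulo [p] the p-th power is additive and, by Fermat, fixes integer coefficients, so only the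
    exponents change. The explicit [E] replaces reduction modulo [p]. *)
Lemma frobenius p P : prime p -> exists E, P ^+ p = dilate p P + E *+ p.
Proof.
move=> pp; elim/poly2_ind: P => [|P P' [E PE] [E' PE']|c u].
- by exists 0; rewrite rmorph0 mul0rn addr0 expr0n; case: p pp.
- have [e ->] := prime_expD P P' pp; exists (E + E' + e).
  by rewrite PE PE' rmorphD /= !mulrnDl addrACA !addrA.
have [e cE] := int_fermat c pp; exists (cst e * mono (u *+ p)).
rewrite dilate_term exprMn mono_exp /cst -!polyC_exp cE.
by rewrite !polyCD !polyCMn mulrDl mulrnAl.
Qed.

Definition norm1 P : nat :=
  (\sum_(i < grid P) \sum_(j < grid P) absz (P`_i`_j)%R)%N.

Lemma act_dilate k P h z : act (dilate k P) h z =
  \sum_(i < grid P) \sum_(j < grid P) P`_i`_j * h (z + emb ((val j, val i) *+ k)).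
Proof.
rewrite {1}[P]poly2_sum rmorph_sum /= act_sum; apply: eq_bigr => i _.
rewrite rmorph_sum /= act_sum; apply: eq_bigr => j _.
by rewrite dilate_term act_mono.
Qed.

(** Dilation moves exponents but keeps coefficients, so the bound is uniform in [k]. *)
Lemma act_dilate_bound k P h z : (forall z, `|h z| <= 1) ->
  `|act (dilate k P) h z| <= (norm1 P)%:Z.
Proof.
move=> h1; rewrite act_dilate /norm1.
rewrite (big_morph Posz PoszD (erefl _)).
apply: (le_trans (ler_norm_sum _ _ _)); apply: ler_sum => i _.
rewrite (big_morph Posz PoszD (erefl _)).
apply: (le_trans (ler_norm_sum _ _ _)); apply: ler_sum => j _.
by rewrite normrM abszE ler_piMr.
Qed.

(** P(X^k)^p kills h, so by the Frobenius congruence P(X^(k p)) h is a multiple of p. Its absolute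
    value is at most [norm1 P], which is less than [p], so it is zero. *)
Lemma act_dilate_prime k p P h : prime p -> (norm1 P < p)%N ->
    (forall z, `|h z| <= 1) -> (forall z, act (dilate k P) h z = 0) ->
  forall z, act (dilate (k * p) P) h z = 0.
Proof.
move=> pp Pp h1 Ph z; have [E] := frobenius (dilate k P) pp.
move/(congr1 (fun Q => act Q h z)); rewrite actD dilate_comp.
rewrite -[p in _ ^+ p]prednK ?prime_gt0 //.
rewrite exprSr actM act_fun0 // => /esym/eqP; rewrite addr_eq0 => /eqP EE.
have := act_dilate_bound (k * p) P z h1; rewrite EE.
have -> : act (E *+ p) h z = act E h z *+ p.
  by elim: (p) => [|m IH]; rewrite ?mulr0n ?act0 // !mulrS actD IH.
rewrite normrN normrMn; have [->|n0] := eqVneq (act E h z) 0.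
  by rewrite mul0rn oppr0.
move: n0; rewrite -absz_eq0 -lt0n -abszE -mulr_natr natz -PoszM lez_nat => n0.
move/(leq_ltn_trans)/(_ Pp); by rewrite ltnNge leq_pmull.
Qed.

(** The prime factors of [k] are brought in one at a time, under the same bound at each stage. *)
Lemma act_dilate_eq0 k P h : (0 < k)%N ->
    (forall p, prime p -> (p %| k)%N -> (norm1 P < p)%N) ->
    (forall z, `|h z| <= 1) -> (forall z, act P h z = 0) ->
  forall z, act (dilate k P) h z = 0.
Proof.
move=> + + h1 Ph; elim/ltn_ind: k => k IH k0 kp.
have [k1|k1] := leqP k 1.
  have -> : k = 1%N by apply/eqP; rewrite eqn_leq k1.
  by move=> z; rewrite dilate1.
have pk := pdiv_prime k1; have dk := pdiv_dvd k.
rewrite -(divnK dk); apply: act_dilate_prime => //; first exact: kp.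
apply: IH; first by rewrite ltn_Pdiv ?prime_gt1.
  by rewrite divn_gt0 ?prime_gt0 // dvdn_leq.
by move=> p pp pd; apply: kp => //; apply: dvdn_trans pd (dvdn_div dk).
Qed.

(** * Special annihilators *)

Lemma poly2_terms (P : A) : exists S : seq (nat * nat), uniq S /\
  (forall k, dilate k P = \sum_(u <- S) cst P`_u.2`_u.1 * mono (u *+ k)) /\
  (forall u, P`_u.2`_u.1 != 0 -> u \in S).
Proof.
exists [seq (val j, val i) | i <- enum 'I_(grid P), j <- enum 'I_(grid P)].
split; [|split=> [k|[j i] /= Pij]].
- apply: allpairs_uniq; rewrite ?enum_uniq // => -[i j] [i' j'] _ _ /= [].
  by move=> /val_inj-> /val_inj->.
- rewrite {1}[P]poly2_sum rmorph_sum /= big_allpairs_dep /= [RHS]big_enum.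
  apply: eq_bigr => i _; rewrite rmorph_sum /= [RHS]big_enum.
  by apply: eq_bigr => j _; rewrite dilate_term.
have /andP[gi gj] : ((i < grid P) && (j < grid P))%N.
  by apply: contraNT Pij => /grid_out->.
by apply/allpairsP; exists (Ordinal gi, Ordinal gj); rewrite !mem_enum.
Qed.

Lemma poly2_neq0 (P : A) : P != 0 -> exists u : nat * nat, P`_u.2`_u.1 != 0.
Proof.
move=> P0; exists ((size (lead_coef P)).-1, (size P).-1) => /=.
by rewrite -lead_coefE -lead_coefE !lead_coef_eq0.
Qed.

Definition diff_op (K : comNzRingType) (ab : Z2 * Z2) : seq (K * Z2) :=
  [:: (1, ab.1); (-1, ab.2)].

Lemma act_diff u v h z :
  act (mono u - mono v) h z = h (z + emb u) - h (z + emb v).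
Proof.
have -> : mono u - mono v = cst 1 * mono u + cst (-1) * mono v.
  by rewrite /cst !polyCN !polyC1 mul1r mulN1r.
by rewrite actD !act_mono mul1r mulN1r.
Qed.

(** Carries an integral annihilator over to [K] with its factorization, since windows are built
    factor by factor. *)
Lemma lops_diff (K : comNzRingType) u (S : seq (nat * nat)) h z :
  lops [seq diff_op K (emb u, emb v) | v <- S] (fun z => (h z)%:~R) z =
  (act (\prod_(v <- S) (mono u - mono v)) h z)%:~R.
Proof.
elim: S z => [|v S IH] z.
  have -> : \prod_(v <- [::]) (mono u - mono v) = cst 1 * mono 0.
    by rewrite big_nil /cst /mono /= !expr0 !polyC1 !mul1r.
  by rewrite act_mono mul1r addr0.
rewrite big_cons actM act_diff intrB /= /lop !big_cons big_nil /= !IH.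
by rewrite addr0 mul1r mulN1r.
Qed.

(* The [dilate (1 + i r) P] kill [h] for all [i]; combining them with the
   coefficients of [\prod_(v != u) (T - X^(r v))] isolates the term of [P] at
   [u]. *)
Lemma special_annihilator (P : A) : P != 0 ->
  exists s : seq (Z2 * Z2), (forall ab, ab \in s -> ab.1 != ab.2) /\
    forall (K : comNzRingType) (h : Z2 -> int), (forall z, `|h z| <= 1) ->
      (forall z, act P h z = 0) ->
      killeds (map (diff_op K) s) (fun z => (h z)%:~R).
Proof.
move=> /poly2_neq0[u Pu]; have [S [uS [PS SP]]] := poly2_terms P.
(* With this factorial [r], every prime dividing 1 + i r exceeds [norm1 P]. *)
have uinS := SP u Pu; pose r := (norm1 P)`!.
have r0 : (0 < r)%N by apply: fact_gt0.
pose S' := [seq v <- S | v != u].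
exists [seq (emb (u *+ r), emb (v *+ r)) | v <- S']; split.
  move=> ab /mapP[v]; rewrite mem_filter => /andP[vu _] -> /=.
  apply: contraNneq vu; rewrite !mulrn_nat_pair => -[/eqP + /eqP].
  rewrite !eqn_pmul2r // eq_sym => /eqP e1 /eqP e2.
  by rewrite [v]surjective_pairing e1 -e2 -surjective_pairing.
move=> K h h1 Ph.
have Pk i z : act (dilate (1 + i * r) P) h z = 0.
  apply: act_dilate_eq0 => // p pp; rewrite ltnNge; apply: contraL => pN.
  have pr : (p %| r)%N by rewrite dvdn_fact // prime_gt0.
  by rewrite dvdn_addl ?dvdn_mull // Euclid_dvd1.
pose V : {poly A} := \prod_(v <- S') ('X - (mono (v *+ r))%:P).
(* The exponent v contributes a multiple of X^v V(X^(r v)), and X^(r v) is a root of [V] unless v =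
   u. *)
have VE : \sum_(i < size V) V`_i * dilate (1 + i * r) P =
    cst P`_u.2`_u.1 * mono u * V.[mono (u *+ r)].
  transitivity (\sum_(v <- S) cst P`_v.2`_v.1 * mono v * V.[mono (v *+ r)]).
    under eq_bigr do rewrite PS mulr_sumr.
    rewrite exchange_big; apply: eq_bigr => v _ /=.
    rewrite horner_coef mulr_sumr; apply: eq_bigr => i _.
    rewrite mulrnDr mulr1n mono_add mulnC mulrnA mono_exp; ring.
  rewrite (bigD1_seq u) //= big_seq_cond big1 ?addr0 // => v /andP[vS vu].
  rewrite horner_prod (big_rem v) /= ?mem_filter ?vu //.
  by rewrite hornerXsubC subrr mul0r mulr0.
move=> z; rewrite -map_comp.
rewrite (_ : map _ _ = [seq diff_op K (emb (u *+ r), emb v) |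
    v <- [seq v *+ r | v <- S']]);
  last by rewrite -[RHS]map_comp.
rewrite lops_diff big_map (_ : act _ h z = 0) //.
(* Evaluating at z - u undoes the factor X^u, and the nonzero integer coefficient at [u] cancels. *)
have := congr1 (fun Q => act Q h (z - emb u)) VE.
rewrite act_sum big1 => [|i _]; last by rewrite actM act_fun0.
rewrite actM act_mono subrK => /esym/eqP; rewrite mulf_eq0 (negPf Pu) => /eqP <-.
by rewrite horner_prod; congr (act _ h z); apply: eq_bigr => v _; rewrite hornerXsubC.
Qed.

(** * The characteristic annihilator of a perfect coloring *)

Definition indicator n (c : config n) (i : 'I_n) : Z2 -> int :=
  fun z => (c z == i)%:R.

Lemma indicator_bound n (c : config n) i z : `|indicator c i z| <= 1.
Proof. by rewrite /indicator; case: (c z == i). Qed.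

Lemma perfect_coloring_sum n D (B : 'M[int]_n) (c : config n) i z :
    perfect_coloring D B c ->
  \sum_(d <- D) indicator c i (z + d) = \sum_j B i j * indicator c j z.
Proof.
move=> /(_ i (c z) z erefl) E.
rewrite (bigD1 (c z)) //= [X in _ = _ + X]big1 => [|j jc]; last first.
  by rewrite /indicator eq_sym (negPf jc) mulr0.
rewrite {2}/indicator eqxx mulr1 addr0 -E -sum1_size big_fset /= [in RHS]big_mkcond /=.
transitivity (\sum_(d <- D) (if c (z + d)%R == i then 1 else 0))%N%:Z.
  rewrite -[RHS]natz natr_sum; apply: eq_bigr => d _.
  by rewrite /indicator; case: ifP.
by congr Posz; symmetry; apply: big_imfset => x y _ _ /addrI.
Qed.

Lemma emb_absz (d : Z2) (m : nat) : (absz d.1 + absz d.2 <= m)%N ->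
  emb (absz (d.1 + m%:Z), absz (d.2 + m%:Z)) = d + emb (m, m).
Proof. by case: d => a b /= dm; congr (_, _) => /=; lia. Qed.

(** The shape polynomial has exponents -d, while [act] calls for exponents d + (m, m). The
    reflection z -> (m, m) - z matches them; all coordinates under [absz] are nonnegative here. *)
Lemma opp_eq_absz (z d : Z2) (m : nat) : z.1 <= m%:Z -> z.2 <= m%:Z ->
    emb (absz (d.1 + m%:Z), absz (d.2 + m%:Z)) = d + emb (m, m) ->
  (z == - d) = (absz (m%:Z - z.2) == absz (d.2 + m%:Z)) &&
               (absz (m%:Z - z.1) == absz (d.1 + m%:Z)).
Proof.
case: z d => x y [a b] /= xm ym; rewrite /emb /= => -[e1 e2].
rewrite xpair_eqE /=; apply/andP/andP => -[/eqP h1 /eqP h2].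
  by split; apply/eqP; lia.
by split; apply/eqP; lia.
Qed.

Lemma horner_char_poly (R : comNzRingType) n (B : 'M[R]_n) (x : R) :
  (char_poly B).[x] = \det (x%:M - B).
Proof.
rewrite /char_poly -horner_evalE -det_map_mx; congr (\det _).
apply/matrixP => i k; rewrite !mxE /= horner_evalE hornerD hornerN hornerC.
by rewrite hornerMn hornerX.
Qed.

Section CharacteristicAnnihilator.
Variables (D : {fset Z2}) (n : nat) (B : 'M[int]_n).

(** Translation by (M, M) brings [D] into the first quadrant, so that ordinary polynomials
    suffice. *)
Definition offset : nat := \max_(d <- D) (absz d.1 + absz d.2)%N.
Local Notation M := offset.
Local Notation corner := (M, M).
Definition up (d : Z2) : nat * nat := (absz (d.1 + M%:Z), absz (d.2 + M%:Z)).

Lemma emb_up d : d \in D -> emb (up d) = d + emb corner.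
Proof.
move=> dD; apply: emb_absz.
exact: (@leq_bigmax_seq _ _ _ (fun d : Z2 => absz d.1 + absz d.2)%N).
Qed.

Definition shifted_shape : A := \sum_(d <- D) mono (up d).
Local Notation phi := shifted_shape.
(** This is f_D - B, with f_D read as the sum of the X^d to suit [act], multiplied by X^(M, M). *)
Definition char_mat : 'M[A]_n := phi%:M - mono corner *: map_mx cst B.
Definition char_det : A := \det char_mat.


(** By perfectness each row of [char_mat] kills the vector of indicators; multiplying by the
    adjugate leaves the determinant acting on each indicator. *)
Lemma act_char_det (c : config n) i z : perfect_coloring D B c ->
  act char_det (indicator c i) z = 0.
Proof.
move=> cB.
have m1 v : mono v = cst 1 * mono v by rewrite /cst !polyC1 mul1r.
have row0 k y : \sum_j act (char_mat k j) (indicator c j) y = 0.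
  pose y' := y + emb corner.
  have E j : act (char_mat k j) (indicator c j) y =
      (\sum_(d <- D) indicator c j (y' + d)) *+ (k == j) - B k j * indicator c j y'.
    rewrite !mxE.
    have -> : phi *+ (k == j) - mono corner * cst (B k j) =
        phi *+ (k == j) + cst (- B k j) * mono corner.
      by rewrite /cst !polyCN mulNr [_ * mono _]mulrC.
    rewrite actD act_mono mulNr; congr (_ - _).
    case: (k == j); last by rewrite !mulr0n act0.
    rewrite !mulr1n act_sum big_seq [RHS]big_seq; apply: eq_bigr => d dD.
    by rewrite m1 act_mono mul1r emb_up // /y' [d + _]addrC addrA.
  under eq_bigr do rewrite E.
  rewrite sumrB (bigD1 k) //= eqxx mulr1n [X in _ + X - _]big1 => [|j]; last first.
    by rewrite eq_sym => /negPf->; rewrite mulr0n.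
  by rewrite addr0 (perfect_coloring_sum _ _ cB) subrr.
transitivity (\sum_j act ((\adj char_mat *m char_mat) i j) (indicator c j) z).
  rewrite mul_adj_mx (bigD1 i) //= mxE eqxx mulr1n big1 ?addr0 // => j.
  by rewrite mxE eq_sym => /negPf->; rewrite mulr0n act0.
under eq_bigr do rewrite mxE act_sum.
rewrite exchange_big /= big1 // => k _.
under eq_bigr do rewrite actM.
rewrite -act_fun_sum act_fun0 // => y; exact: row0.
Qed.

Lemma coef_phi i j :
  phi`_i`_j = \sum_(d <- D) ((i == (up d).2) && (j == (up d).1))%:R.
Proof.
by rewrite /phi coef_sum coef_sum; apply: eq_bigr => d _; rewrite coef_mono.
Qed.

(** The hypothesis reads phi = t X^(M, M), which becomes f_D = t after reflecting exponents. Outside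
    the reflected quadrant both sides have coefficient zero. *)
Lemma shape_poly_sub_eq0 (K : fieldType) (t : K) :
    (forall i j, (phi`_i`_j)%:~R = t * ((mono corner)`_i`_j)%:~R) ->
  shape_poly_sub D t = 0.
Proof.
move=> E; apply/malgP => z; rewrite mcoeff0 /shape_poly_sub coeffB coeffU.
apply/eqP; rewrite subr_eq0 eq_sym; apply/eqP.
rewrite /shape_poly raddf_sum /=; under eq_bigr do rewrite coeffU mul1r.
have [/andP[z1 z2]|zN] := boolP ((z.1 <= M%:Z) && (z.2 <= M%:Z)).
  have := E (absz (M%:Z - z.2)) (absz (M%:Z - z.1)).
  rewrite coef_phi coef_mono rmorph_sum /= rmorph_nat => Ez.
  transitivity (t * ((absz (M%:Z - z.2) == M) && (absz (M%:Z - z.1) == M))%:R).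
    congr (_ * _%:R); congr nat_of_bool; case: z {E Ez} z1 z2 => x y /= xM yM.
    rewrite xpair_eqE andbC; congr (_ && _); lia.
  rewrite -Ez big_seq [RHS]big_seq; apply: eq_bigr => d dD.
  rewrite rmorph_nat; congr (nat_of_bool _)%:R.
  by rewrite (opp_eq_absz z1 z2 (emb_up dD)).
rewrite [z == 0](_ : _ = false) ?mulr0 1?big_seq ?big1 //.
  move=> d dD; case: eqP => // zd; case/negP: zN; have := emb_up dD.
  by rewrite zd; case: d {dD zd} => a b [] /=; lia.
by apply: contraNF zN => /eqP->.
Qed.

(** If the determinant vanished, x = phi / X^(M, M) would be a root of the characteristic polynomial
    of [B] in the fraction field [L]. That polynomial splits over [K], so x would be a constant
    eigenvalue t, forcing f_D = t. *)
Lemma char_det_neq0 (K : closedFieldType) :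
    (forall t : K, root (char_poly (map_mx intr B)) t -> shape_poly_sub D t != 0) ->
  char_det != 0.
Proof.
move=> shape; apply: contraT; rewrite negbK => /eqP F0.
pose L := {fraction {poly {poly K}}}.
pose toK : {rmorphism A -> {poly {poly K}}} := map_poly (map_poly intr).
pose io : {rmorphism A -> L} := @tofrac _ \o toK.
pose j : {rmorphism K -> L} := @tofrac _ \o (polyC \o polyC).
pose BK : 'M[K]_n := map_mx intr B.
pose x : L := io phi / io (mono corner).
have coef_toK P k l : (toK P)`_k`_l = (P`_k`_l)%:~R by rewrite !coef_map.
have toK_cst b : toK (cst b) = (b%:~R)%:P%:P.
  by apply/polyP => k; apply/polyP => l; rewrite coef_toK /cst !coefC; case: (k == 0%N);
    rewrite ?coefC ?coef0 //; case: (l == 0%N).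
have mu0 : io (mono corner) != 0.
  rewrite tofrac_eq0; apply/eqP => /(congr1 (fun P : {poly {poly K}} => P`_M`_M)).
  by rewrite coef_toK coef_mono !eqxx !coef0 => /eqP; rewrite oner_eq0.
have detx : \det (x%:M - map_mx j BK) = 0.
  have : io char_det = 0 by rewrite F0 rmorph0.
  rewrite -det_map_mx (_ : map_mx _ _ = io (mono corner) *: (x%:M - map_mx j BK)).
    by rewrite detZ => /eqP; rewrite mulf_eq0 expf_eq0 (negPf mu0) andbF => /eqP.
  apply/matrixP => i k; rewrite !mxE rmorphB rmorphMn rmorphM /= mulrBr mulrnAr.
  rewrite [io (mono corner) * x]mulrC divfK //; congr (_ - _ * _).
  by rewrite /io /j /= toK_cst.
have : (char_poly (map_mx j BK)).[x] = 0 by rewrite horner_char_poly.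
rewrite -map_char_poly; have [rs rsE] := closed_field_poly_normal (char_poly BK).
rewrite (monicP (char_poly_monic _)) scale1r in rsE.
rewrite rsE rmorph_prod horner_prod => /eqP; rewrite prodf_seq_eq0 => /hasP[t trs] /=.
rewrite rmorphB /= map_polyX map_polyC hornerXsubC subr_eq0 => /eqP xt.
have : shape_poly_sub D t != 0 by apply: shape; rewrite rsE root_prod_XsubC.
rewrite shape_poly_sub_eq0 ?eqxx // => k l.
have : io phi = j t * io (mono corner) by rewrite -xt divfK.
rewrite /io /j /= -tofracM => /eqP.
rewrite tofrac_eq => /eqP/(congr1 (fun P : {poly {poly K}} => P`_k`_l)) E.
by rewrite !coefCM -!/(toK _) !coef_toK in E.
Qed.

End CharacteristicAnnihilator.

Lemma lop_laurent_mmap (K : fieldType) (q : laurent K) h z :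
  lop (laurent_op q) h z = mmap (@idfun K) (fun u => h (z - u)) q.
Proof. by rewrite lop_laurent mmapE. Qed.

Lemma lop_shape (K : fieldType) (D : {fset Z2}) (t : K) h z :
  lop (laurent_op (shape_poly_sub D t)) h z =
  \sum_(d <- D) h (z + d) - t * h z.
Proof.
rewrite lop_laurent_mmap raddfB /= mmapU /= subr0; congr (_ - _).
rewrite /shape_poly raddf_sum; apply: eq_bigr => d _.
by rewrite /= mmapU /= mul1r opprK.
Qed.

(** On the vector of indicators f_D acts as [B], so the product of the f_D - t acts as the
    characteristic polynomial evaluated at [B], which is zero by Cayley-Hamilton. *)
Lemma perfect_coloring_killed (K : fieldType) n D (B : 'M[int]_n.+1) (c : config n.+1)
    (rs : seq K) :
    perfect_coloring D B c -> char_poly (map_mx intr B) = \prod_(t <- rs) ('X - t%:P) ->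
  forall i, killeds [seq laurent_op (shape_poly_sub D t) | t <- rs]
    (fun z => (indicator c i z)%:~R).
Proof.
move=> cB rsE i z; pose BK : 'M[K]_n.+1 := map_mx intr B.
pose g j z : K := (indicator c j z)%:~R.
have step j y : \sum_(d <- D) g j (y + d) = \sum_k BK j k * g k y.
  rewrite /g -rmorph_sum (perfect_coloring_sum _ _ cB) rmorph_sum.
  by apply: eq_bigr => k _; rewrite mxE rmorphM.
have gen (s : seq K) y : lops [seq laurent_op (shape_poly_sub D t) | t <- s] (g i) y =
    \sum_k horner_mx BK (\prod_(t <- s) ('X - t%:P)) i k * g k y.
  elim: s y => [|t s IH] y.
    rewrite big_nil rmorph1 (bigD1 i) //= mxE eqxx mul1r big1 ?addr0 // => k.
    by rewrite mxE eq_sym => /negPf->; rewrite mul0r.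
  rewrite big_cons mulrC rmorphM rmorphB /= horner_mx_X horner_mx_C -mulmxE mulmxBr
    mul_mx_scalar.
  set P := horner_mx _ _ in IH *; rewrite (eq_lop _ IH) lop_shape.
  rewrite exchange_big /=; under eq_bigr do rewrite -mulr_sumr step mulr_sumr.
  rewrite exchange_big /= mulr_sumr -sumrB; apply: eq_bigr => k _.
  rewrite !mxE mulrBl mulr_suml; congr (_ - _).
    by apply: eq_bigr => j _; rewrite mulrA.
  by rewrite mulrA.
rewrite (gen rs z) -rsE Cayley_Hamilton big1 // => k _.
by rewrite mxE mul0r.
Qed.

(** * Finite windows and periods *)

Lemma determined_diff (K : closedFieldType) (q : laurent K) (ab : Z2 * Z2) :
    ab.1 != ab.2 -> ~ has_line_factor q ->
  determined (fun h => killed (laurent_op q) h /\ killed (diff_op K ab) h).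
Proof.
move=> ab0 nq; have v0 : ab.1 - ab.2 != 0 by rewrite subr_eq0.
apply: determined_sub (determined_translate v0 nq) => h [qh dh]; split=> // z.
have := dh (z - ab.2); rewrite /lop /diff_op !big_cons big_nil /= addr0 mul1r mulN1r.
by rewrite subrK addrAC -addrA => /eqP; rewrite subr_eq0 => /eqP.
Qed.

(** Pigeonhole: among more translates by multiples of [t] than there are patterns on [W], two show
    the same pattern. The difference of the corresponding translated indicators satisfies [P] and
    vanishes on [W], hence everywhere. *)
Lemma determined_periodic (K : numDomainType) n (c : config n)
    (P : (Z2 -> K) -> Prop) (t : Z2) :
    determined P -> (forall l h, P h -> P (lop l h)) ->
    (forall i, P (fun z => (indicator c i z)%:~R)) ->
  exists2 k : int, k != 0 & forall u, c (u + t *~ k) = c u.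
Proof.
move=> [W HW] Plop Pc.
pose f (k : 'I_(#|{: (size W).-tuple 'I_n}|.+1)) :=
  [tuple of [seq c (w + t *~ k%:Z) | w <- in_tuple W]].
have /injectivePn[k [k' kk' fk]] : ~~ injectiveb f.
  by apply/negP => /injectiveP/leq_card; rewrite card_ord ltnn.
exists (k'%:Z - k%:Z); first by rewrite subr_eq0 eqz_nat eq_sym.
pose g i : Z2 -> K := fun z => (indicator c i z)%:~R.
have g0 i z : lop (diff_op K (t *~ k%:Z, t *~ k'%:Z)) (g i) z = 0.
  apply: (HW _ (Plop _ _ (Pc i))) => w wW.
  rewrite /lop /diff_op !big_cons big_nil /= addr0 mul1r mulN1r.
  move/(congr1 (fun s : (size W).-tuple 'I_n => nth i s (index w W))): fk.
  rewrite /= !(nth_map w) ?index_mem // !nth_index // => E.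
  by rewrite /g /indicator E subrr.
(* The indicator of the letter at [u] equals 1 there, hence also at the translated point. *)
move=> u; have := g0 (c u) (u - t *~ k%:Z).
rewrite /lop /diff_op !big_cons big_nil /= addr0 mul1r mulN1r subrK.
rewrite /g /indicator eqxx -addrA [- _ + _]addrC -(mulrzBr t) => /eqP.
by rewrite subr_eq0 eqr_int; case: (c _ =P c u).
Qed.

(** Stating the hypothesis for the eigenvalues of [B] serves both halves of the theorem: a nonzero
    det(B - t0 I) says that t0 is not an eigenvalue. *)
Lemma two_periodic_perfect_coloring (K : numClosedFieldType) (D : {fset Z2}) n
    (B : 'M[int]_n) (c : config n) :
    (forall t : K, root (char_poly (map_mx intr B)) t ->
      ~ has_line_factor (shape_poly_sub D t)) ->
  perfect_coloring D B c -> two_periodic c.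
Proof.
case: n B c => [|n] B c nolf cB; first by case: (c 0).
have [s [s_neq s_kills]] : exists s : seq (Z2 * Z2),
    (forall ab, ab \in s -> ab.1 != ab.2) /\
    forall (K : comNzRingType) (h : Z2 -> int), (forall z, `|h z| <= 1) ->
      (forall z, act (char_det D B) h z = 0) ->
      killeds (map (diff_op K) s) (fun z => (h z)%:~R).
  apply/special_annihilator/(@char_det_neq0 _ _ _ K) => t /nolf.
  move=> nlf; apply: contra_notN nlf => /eqP->.
  (* The zero polynomial is divisible by the line polynomial x - 1. *)
  exists (binom (1, 0) 1); last exact: ldvd0.
  by apply: line_binom; rewrite ?oner_eq0.
have [rs rsE] := closed_field_poly_normal (char_poly (map_mx intr B) : {poly K}).
rewrite (monicP (char_poly_monic _)) scale1r in rsE.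
pose P (h : Z2 -> K) :=
  killeds [seq laurent_op (shape_poly_sub D t) | t <- rs] h /\
  killeds (map (diff_op K) s) h.
have Pdet : determined P.
  apply: determined_lops2 => l m /mapP[t trs ->] /mapP[ab abs ->].
  apply: determined_diff; first exact: s_neq.
  by apply: nolf; rewrite rsE root_prod_XsubC.
have Plop l h : P h -> P (lop l h) by move=> [h1 h2]; split; apply: killeds_lop.
have Pc i : P (fun z => (indicator c i z)%:~R).
  split; first exact: perfect_coloring_killed cB rsE i.
  apply: s_kills => [z|z]; first exact: indicator_bound.
  exact: act_char_det.
have [k k0 ck] := determined_periodic (1, 0) Pdet Plop Pc.
have [l l0 cl] := determined_periodic (0, 1) Pdet Plop Pc.
exists ((1, 0) *~ k), ((0, 1) *~ l); split; last by [].
move=> a b; rewrite !mulrz_pair /= !(mul1r, mul0r) => -[].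
rewrite addr0 add0r => /eqP + /eqP; rewrite !mulf_eq0 (negPf k0) (negPf l0) /=.
by move=> /eqP-> /eqP->.
Qed.

Theorem theorem17 (R : realType) (D : {fset Z2}) :
  (forall t0 : int,
     (forall t : R[i], t != t0%:~R -> ~ has_line_factor (shape_poly_sub D t)) ->
     forall (n : nat) (B : 'M[int]_n) (c : config n),
       perfect_coloring D B c -> \det (B - t0%:M) != 0 -> two_periodic c) /\
  ((forall t : R[i], ~ has_line_factor (shape_poly_sub D t)) ->
     forall (n : nat) (B : 'M[int]_n) (c : config n),
       perfect_coloring D B c -> two_periodic c).
Proof.
split=> [t0 nolf n B c cB detB|nolf n B c].
  apply: (@two_periodic_perfect_coloring R[i] D n B) cB => t Bt.
  (* An eigenvalue equal to t0 would be a root of the integral characteristic polynomial, so det(t0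
     I - B), which is det(B - t0 I) up to sign, would vanish. *)
  apply: nolf; apply: contraNneq detB => tE; move: Bt.
  rewrite tE -map_char_poly.
  rewrite rootE horner_map /= intr_eq0 horner_char_poly.
  rewrite -opprB -scaleN1r detZ mulf_eq0 expf_eq0 oppr_eq0.
  by rewrite oner_eq0 andbF.
exact: (@two_periodic_perfect_coloring R[i] D n B).
Qed.
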